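(* Let $\mathbb{F}_q$ be a finite field with $q$ elements. Let $p, n, k$ be integers satisfying $0 < p \leq n \leq k-1$, and let $$(\lambda_1, \lambda_2, \ldots, \lambda_k) = (p+(k-1)n,\ p+(k-2)n,\ \ldots,\ p+n,\ p).$$ Let $z_1, z_2, z_3, \ldots$ be elements of $\mathbb{F}_q$ chosen uniformly and independently at random. Then the probability that $$\det\left( J_{\lambda_1, \lambda_2, \ldots, \lambda_k}(z_1, z_2, z_3, \ldots) \right) = 0$$ is $$1- \prod_{i=1}^{n} \left(1-\frac{1}{q^{i}}\right).$$
   Context: For integers $\lambda_1 \geq \lambda_2 \geq \cdots \geq \lambda_k \geq 0$, the Jacobi--Trudi matrix is the $k \times k$-matrix $$J_{\lambda_1, \ldots, \lambda_k}(z_1, z_2, z_3, \ldots) := \left( z_{\lambda_i - i + j} \right)_{1\leq i\leq k,\ 1\leq j\leq k},$$ where one sets $z_0 = 1$ and $z_m = 0$ for all $m < 0$. Only finitely many of the $z_m$ appear in the matrix, so the probability is the proportion of tuples $(z_1, \ldots, z_N) \in \mathbb{F}_q^N$ (for any sufficiently large $N$) for which the determinant vanishes. *)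

(* Defs.v *)
From mathcomp Require Import all_boot all_order all_algebra.

Set Implicit Arguments.
Unset Strict Implicit.
Unset Printing Implicit Defensive.

Import GRing.Theory Num.Theory.
Local Open Scope ring_scope.

(* [z m] stands for z_m when m >= 1; the value [z 0] is never used, since
   z_0 = 1 by convention. *)
Definition jt_coef (R : nzRingType) (z : nat -> R) (m : int) : R :=
  match m with
  | Posz 0 => 1
  | Posz l.+1 => z l.+1
  | Negz _ => 0
  end.

(* Rows and columns are numbered from 0, and [lam i] is lambda_(i+1); the two
   shifts cancel in lambda_i - i + j. *)
Definition jacobi_trudi (R : nzRingType) (k : nat) (lam : 'I_k -> nat)
    (z : nat -> R) : 'M[R]_k :=
  \matrix_(i, j) jt_coef z ((lam i)%:Z - (i : nat)%:Z + (j : nat)%:Z).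

(* lambda_(i+1) = p + (k - (i+1)) n *)
Definition stair (p n k : nat) (i : 'I_k) : nat := (p + (k - i.+1) * n)%N.

(* The tuple (z_1, ..., z_N) as a sequence numbered from 1; the junk value 0
   is taken at indices larger than N. *)
Definition seq_of_tuple (R : nzRingType) (N : nat) (t : N.-tuple R) (m : nat) : R :=
  t`_m.-1.

Definition proportion (T : finType) (A : {set T}) : rat := #|A|%:R / #|T|%:R.

(* Main.v *)
(* Put d = n + 1.  With rows and columns reversed, the matrix has entries
   z_(p + d i - j).  Splitting columns by their residue s modulo d turns it
   into d lower triangular Toeplitz blocks, of widths kap_s summing to k, made
   from d power series t_s: a vector in the kernel is a family of polynomials
   b_s of size at most kap_s such that the coefficients of index < k of
   sum_s b_s t_s vanish.

   If all kap_s are positive, the constant terms are fixed and not all zero, and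
   the other coefficients are uniform, the matrix is regular with probability
   prod_(1 <= i < d) (1 - q^-i), whatever the widths and the constant terms.
   Indeed, pick r with t_r(0) != 0 and kap_r maximal.  Replacing t_s by
   (t_s - a_s t_r) / y for s != r, with a_s = t_s(0) / t_r(0), and kap_r by
   kap_r - 1 is Gaussian elimination of one row and one column.  It gives a
   system of the same kind, whose constant terms other than that of t_r are
   uniform.  If kap_r was 1, block r disappears and d - 1 blocks with uniform
   constant terms remain: these all vanish with probability q^-(d - 1), and
   then the matrix has a zero row. *)

Require Import Defs.
From mathcomp Require Import all_boot all_order all_algebra.
From mathcomp Require Import zify.

Set Implicit Arguments.
Unset Strict Implicit.
Unset Printing Implicit Defensive.

Import GRing.Theory Num.Theory.
Local Open Scope ring_scope.

(** * Systems of series and their kernels *)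

Section Counting.

Variables (F : finFieldType) (I : finType) (N : nat).
Implicit Types (kap : I -> nat) (s r : I) (p : I -> {poly F}).

(* [w i s] is the coefficient of degree [i] of the series [t_s]. *)
Definition seqs := {ffun 'I_N.+1 -> {ffun I -> F}}.
Implicit Types (w : seqs) (H : pred seqs).

Definition series w s : {poly F} := \poly_(i < N.+1) w (inord i) s.

(** One slot per unknown coefficient: the candidates for kernel vectors form a finite type, so
    [nonsingular] can quantify over them as a boolean. *)
Definition slots kap := {s : I & 'I_(kap s)}.

Definition poly_of_slots kap (b : {ffun slots kap -> F}) s : {poly F} :=
  \poly_(c < kap s)
    if (insub c : option 'I_(kap s)) is Some c'
    then b (Tagged (fun s => 'I_(kap s)) c') else 0.

Definition nonsingular kap w :=
  [forall b : {ffun slots kap -> F},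
    [forall i : 'I_(\sum_s kap s),
       (\sum_s poly_of_slots b s * series w s)`_i == 0] ==> (b == 0)].

Lemma card_slots kap : #|{: slots kap}| = (\sum_s kap s)%N.
Proof.
rewrite card_tagged sumnE big_map big_enum /=.
by apply: eq_bigr => s _; rewrite card_ord.
Qed.

Lemma coef_poly_of_slots kap (b : {ffun slots kap -> F}) s (c : 'I_(kap s)) :
  (poly_of_slots b s)`_c = b (Tagged (fun s => 'I_(kap s)) c).
Proof. by rewrite coef_poly ltn_ord valK. Qed.

Lemma size_poly_of_slots kap (b : {ffun slots kap -> F}) s :
  (size (poly_of_slots b s) <= kap s)%N.
Proof. exact: size_poly. Qed.

Lemma poly_of_slotsB kap (b c : {ffun slots kap -> F}) s :
  poly_of_slots (b - c) s = poly_of_slots b s - poly_of_slots c s.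
Proof.
apply/polyP => i; rewrite coefB !coef_poly.
case: ltnP => [lti|_]; last by rewrite subr0.
by rewrite insubT !ffunE.
Qed.

Lemma poly_of_slots_eq0 kap (b : {ffun slots kap -> F}) :
  (forall s, poly_of_slots b s = 0) -> b = 0.
Proof.
move=> b0; apply/ffunP => -[s c].
by have := coef_poly_of_slots b c; rewrite b0 coef0 ffunE => <-.
Qed.

Lemma poly_of_slotsK kap p :
  (forall s, (size (p s) <= kap s)%N) ->
  forall s, poly_of_slots [ffun x : slots kap => (p (tag x))`_(tagged x)] s = p s.
Proof.
move=> szp s; apply/polyP => i; rewrite coef_poly.
case: ltnP => [lti|lei]; first by rewrite insubT ffunE.
by rewrite nth_default // (leq_trans (szp s)).
Qed.

Lemma nonsingularP kap w :
  reflect (forall p, (forall s, (size (p s) <= kap s)%N) ->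
             (forall i, (i < \sum_s kap s)%N ->
                (\sum_s p s * series w s)`_i = 0) ->
             forall s, p s = 0)
          (nonsingular kap w).
Proof.
apply: (iffP idP) => [/forallP ns p szp pt s | ns].
  pose b := [ffun x : slots kap => (p (tag x))`_(tagged x)].
  have pE : forall s, poly_of_slots b s = p s by exact: poly_of_slotsK.
  have b0 : b = 0.
    apply/eqP; have /implyP := ns b; apply; apply/forallP => -[i lti].
    rewrite (eq_bigr _ (fun r _ => congr1 (fun P => P * series w r) (pE r))).
    exact/eqP/pt.
  rewrite -pE; apply/polyP => i; rewrite coef_poly coef0 b0.
  by case: ltnP => // lti; rewrite insubT ffunE.
apply/forallP => b; apply/implyP => /forallP bt; apply/eqP.
apply: poly_of_slots_eq0; apply: ns => [s|i lti]; first exact: size_poly_of_slots.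
by have /eqP := bt (Ordinal lti).
Qed.

(** Pigeonhole: there are more families than values of the first [L] coefficients, so two families
    agree there and their difference is in the kernel. *)
Lemma exists_kernel kap w L : (L < \sum_s kap s)%N ->
  exists2 p : I -> {poly F},
             (forall s, (size (p s) <= kap s)%N) /\
             (forall i, (i < L)%N -> (\sum_s p s * series w s)`_i = 0)
           & exists s, p s != 0.
Proof.
move=> ltL.
pose f (b : {ffun slots kap -> F}) :=
  [ffun i : 'I_L => (\sum_s poly_of_slots b s * series w s)`_i].
have /injectivePn[b [c neq_bc fbc]] : ~~ injectiveb f.
  apply/negP => /injectiveP/leq_card; rewrite !card_ffun card_slots card_ord.
  rewrite leq_exp2l ?card_finNzRing_gt1 // => leL.
  by have := leq_ltn_trans leL ltL; rewrite ltnn.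
exists (poly_of_slots (b - c)).
  split=> [s|i lti]; first exact: size_poly_of_slots.
  have := congr1 (fun g : {ffun 'I_L -> F} => g (Ordinal lti)) fbc.
  rewrite [LHS in LHS = _ -> _]ffunE [RHS in _ = RHS -> _]ffunE /= => fi.
  under eq_bigr do rewrite poly_of_slotsB mulrBl.
  by rewrite sumrB coefB fi subrr.
apply/existsP; rewrite -negb_forall; apply: contra neq_bc => /forallP b0.
rewrite -subr_eq0; apply/eqP/poly_of_slots_eq0 => s; exact/eqP.
Qed.

Lemma coef_series w s (i : 'I_N.+1) : (series w s)`_i = w i s.
Proof. by rewrite coef_poly ltn_ord inord_val. Qed.

(** All series in play are divisible by ['X], so the equation in degree 0 is void; the quotients
    [w'] satisfy one equation fewer than there are unknowns. *)
Lemma zero_row_singular kap w : (0 < \sum_s kap s)%N ->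
  (forall s, (0 < kap s)%N -> w ord0 s = 0) -> ~~ nonsingular kap w.
Proof.
move=> L_gt0 w0.
have ltL : ((\sum_s kap s).-1 < \sum_s kap s)%N by rewrite prednK.
pose w' : seqs := [ffun i : 'I_N.+1 => [ffun s => (series w s)`_i.+1]].
have [p [szp pt] [s ps0]] := exists_kernel w' ltL.
apply/negP => /nonsingularP/(_ p szp) ns; move/eqP: ps0; apply; apply: ns.
have serE r : (0 < kap r)%N -> series w r = 'X * series w' r.
  move=> kr; apply/polyP => -[|i]; rewrite coefXM /=.
    by rewrite (coef_series w r ord0) w0.
  rewrite [RHS]coef_poly; case: ltnP => lti; last first.
    by rewrite nth_default ?(leq_trans (size_poly _ _)) ?leqW.
  by rewrite !ffunE inordK.
have -> : \sum_r p r * series w r = 'X * (\sum_r p r * series w' r).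
  rewrite mulr_sumr; apply: eq_bigr => r _.
  have [kr|] := ltnP 0 (kap r); first by rewrite serE // mulrCA.
  rewrite leqn0 => /eqP kr; have := szp r.
  by rewrite kr size_poly_leq0 => /eqP ->; rewrite !mul0r mulr0.
move=> [|i] lti; rewrite coefXM //=; apply: pt.
by rewrite -ltnS prednK.
Qed.

Lemma size_sum_leq (P : pred I) p m :
  (forall s, P s -> (size (p s) <= m)%N) ->
  (size (\sum_(s | P s) p s)%R <= m)%N.
Proof. by move=> le_m; apply: (leq_trans (size_sum _ _ _)); apply/bigmax_leqP. Qed.

(** * One step of Gaussian elimination *)

(* The coefficients of [(t_s - a_s t_r) / y] for [s != r].  The shift of indices
   is cyclic, so that this is a bijection; the term shifted to the top is 0 when
   the constant terms satisfy [t_s(0) = a_s t_r(0)]. *)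
Definition shear r (a : I -> F) w : seqs :=
  [ffun i => [ffun s => if s == r then w i r
                        else w (ordS i) s - a s * w (ordS i) r]].

Definition unshear r (a : I -> F) w : seqs :=
  [ffun i => [ffun s => if s == r then w i r
                        else w (ord_pred i) s + a s * w i r]].

Lemma shearK r a : cancel (shear r a) (unshear r a).
Proof.
move=> w; apply/ffunP => i; apply/ffunP => s; rewrite !ffunE eqxx ord_predK.
by case: eqP => [->|_]; rewrite ?subrK.
Qed.

Lemma unshearK r a : cancel (unshear r a) (shear r a).
Proof.
move=> w; apply/ffunP => i; apply/ffunP => s; rewrite !ffunE eqxx ordSK.
by case: eqP => [->|_]; rewrite ?addrK.
Qed.

Definition shrink kap r s := (kap s - (s == r))%N.

Lemma sum_shrink kap r : (0 < kap r)%N ->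
  \sum_s kap s = (\sum_s shrink kap r s).+1.
Proof.
move=> kr; rewrite (bigD1 r) //= [in RHS](bigD1 r) //= /shrink eqxx.
rewrite -addSn subn1 prednK //; congr (_ + _)%N.
by apply: eq_bigr => s /negbTE->; rewrite subn0.
Qed.

Lemma series_shear_pivot r a w : series (shear r a w) r = series w r.
Proof.
apply/polyP => i; rewrite !coef_poly.
by case: ifP => // _; rewrite !ffunE eqxx.
Qed.

Lemma series_shear r a w s : s != r -> w ord0 s = a s * w ord0 r ->
  series w s = a s *: series w r + 'X * series (shear r a w) s.
Proof.
move=> /negbTE neq_sr w0; apply/polyP => i.
rewrite coefD coefZ coefXM !coef_poly.
have inord0 : inord 0 = ord0 :> 'I_N.+1 by apply: val_inj; rewrite /= inordK.
case: i => [|i] /=; first by rewrite inord0 w0 addr0.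
case: (ltnP i.+1 N.+1) => lti.
  have ltiN : (i < N.+1)%N by apply: ltnW.
  rewrite ltiN !ffunE neq_sr (_ : ordS _ = inord i.+1) 1?addrC ?subrK //.
  by apply: val_inj; rewrite /= !inordK // modn_small.
rewrite mulr0 add0r; case: ltnP => // ltiN.
have eqiN : i = N by apply/eqP; rewrite eqn_leq -ltnS ltiN -ltnS lti.
rewrite !ffunE neq_sr (_ : ordS _ = ord0) ?w0 ?subrr //.
by apply: val_inj; rewrite /= inordK // eqiN modnn.
Qed.

Lemma sum_series_shear r a w p : a r = 1 ->
  (forall s, w ord0 s = a s * w ord0 r) ->
  \sum_s p s * series w s =
    (\sum_s a s *: p s) * series w r
    + 'X * \sum_(s | s != r) p s * series (shear r a w) s.
Proof.
move=> ar w0; rewrite (bigD1 r) //= [in RHS](bigD1 r) //= ar scale1r mulrDl.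
rewrite -addrA; congr (_ + _); rewrite mulr_suml mulr_sumr -big_split /=.
apply: eq_bigr => s neq_sr; rewrite (series_shear neq_sr (w0 s)) mulrDr.
by rewrite -scalerAr -scalerAl mulrCA.
Qed.

(* A kernel element [b] on one side corresponds to [b'] on the other, where
   ['X * b' r] is the combination of the [b s] with coefficients [a s], and
   [b' s = b s] elsewhere. *)
Lemma nonsingular_shear kap r a w : (0 < kap r)%N -> w ord0 r != 0 ->
  a r = 1 -> (forall s, w ord0 s = a s * w ord0 r) ->
  (forall s, a s != 0 -> (kap s <= kap r)%N) ->
  nonsingular (shrink kap r) (shear r a w) = nonsingular kap w.
Proof.
move=> kr wr ar w0 max_r.
apply/nonsingularP/nonsingularP => ns p szp pt.
  rewrite (sum_shrink kr) in pt.
  (* Only blocks with [a s != 0] contribute, and [r] is widest among them. *)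
  have szc : (size (\sum_s a s *: p s)%R <= kap r)%N.
    apply: size_sum_leq => s _.
    have [->|/max_r] := eqVneq (a s) 0; first by rewrite scale0r size_poly0.
    by move=> ?; rewrite (leq_trans (size_scale_leq _ _)) ?(leq_trans (szp s)).
  (* In degree 0 the system says that this constant term times [t_r(0)] is 0. *)
  have c0 : (\sum_s a s *: p s)`_0 = 0.
    have := pt 0%N isT; rewrite (sum_series_shear _ ar w0) coefD coefXM addr0.
    rewrite coef0M (coef_series w r ord0) => /eqP.
    by rewrite mulf_eq0 (negbTE wr) orbF => /eqP.
  pose c := \poly_(i < (kap r).-1) (\sum_s a s *: p s)`_i.+1.
  have cE : \sum_s a s *: p s = 'X * c.
    apply/polyP => -[|i]; rewrite coefXM //= coef_poly.
    case: ltnP => // lei; rewrite nth_default // (leq_trans szc) //.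
    by rewrite -(prednK kr).
  pose p' s := if s == r then c else p s.
  have p'0 : forall s, p' s = 0.
    apply: ns => [s|i lti]; rewrite /p' /shrink.
      by case: eqP => [->|_]; rewrite ?subn1 ?size_poly // subn0.
    have := pt i.+1 lti; rewrite (sum_series_shear _ ar w0) cE -mulrA -mulrDr.
    rewrite coefXM /= [in X in _ -> X](bigD1 r) //= eqxx series_shear_pivot.
    by under [in X in _ -> X]eq_bigr => s /negbTE-> do [].
  have p0 s : s != r -> p s = 0.
    by move=> /negbTE neq_sr; have := p'0 s; rewrite /p' neq_sr.
  move=> s; have [->|] := eqVneq s r; last exact: p0.
  have := p'0 r; rewrite /p' eqxx => c_0; move: cE.
  rewrite c_0 mulr0 (bigD1 r) //= ar scale1r big1 ?addr0 // => s' /p0 ->.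
  by rewrite scaler0.
rewrite (sum_shrink kr) in ns.
(* The pivot component solves [cE] for [p' r], using [a r = 1]. *)
pose p' s := if s == r then 'X * p r - \sum_(s' | s' != r) a s' *: p s'
             else p s.
have cE : \sum_s a s *: p' s = 'X * p r.
  rewrite (bigD1 r) //= /p' eqxx ar scale1r addrC.
  rewrite (eq_bigr (fun s => a s *: p s)) ?addrNK 1?addrC ?subrK //.
  by move=> s /negbTE->.
have szp' s : s != r -> (size (p s) <= kap s)%N.
  by move=> /negbTE neq_sr; have := szp s; rewrite /shrink neq_sr subn0.
have p'0 : forall s, p' s = 0.
  apply: ns => [s|i lti]; rewrite /p'.
    have [->|/szp' //] := eqVneq s r.
    rewrite (leq_trans (size_polyD _ _)) // geq_max size_polyN.
    apply/andP; split.
      rewrite mulrC (leq_trans (size_polyMleq _ _)) // size_polyX addnS /= addn1.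
      by rewrite -(prednK kr) ltnS -subn1 (leq_trans (szp r)) // /shrink eqxx.
    apply: size_sum_leq => s' neq_s'r.
    have [->|/max_r] := eqVneq (a s') 0; first by rewrite scale0r size_poly0.
    move=> ?; rewrite (leq_trans (size_scale_leq _ _)) //.
    by rewrite (leq_trans (szp' s' _)).
  rewrite -/p' (sum_series_shear p' ar w0) cE -mulrA -mulrDr coefXM.
  case: i lti => //= i lti; have := pt i lti.
  rewrite (bigD1 r) //= series_shear_pivot.
  by under [in X in _ -> X]eq_bigr => s /negbTE neq_sr do rewrite /p' neq_sr.
have p0 s : s != r -> p s = 0.
  by move=> /negbTE neq_sr; have := p'0 s; rewrite /p' neq_sr.
move=> s; have [->|] := eqVneq s r; last exact: p0.
move: cE; rewrite big1 => [/esym/eqP|s' _]; last by rewrite p'0 scaler0.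
by rewrite mulf_eq0 polyX_eq0 => /eqP.
Qed.

(** * Counting regular systems *)

Lemma card_set_pred0 (T : finType) (P : pred T) :
  (forall x, ~~ P x) -> #|[set x | P x]| = 0%N.
Proof. by move=> P0; apply: eq_card0 => x; rewrite inE; apply: negbTE. Qed.

Lemma card_fibers (T J : finType) (f : T -> J) (P : pred T) :
  #|[set x | P x]| = (\sum_j #|[set x | P x && (f x == j)]|)%N.
Proof.
rewrite -sum1_card (partition_big f xpredT) //=; apply: eq_bigr => j _.
by rewrite -sum1_card; apply: eq_bigl => x; rewrite !inE.
Qed.

(** Translating row 0 by a vector supported on [A] preserves [H], so the fibres over the values of
    row 0 on [A] all have the size of the fibre over 0. *)
Lemma card_uniform_row0 (A : {set I}) H :
  (forall w w', (forall i, i != ord0 -> w i = w' i) ->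
     (forall s, s \notin A -> w ord0 s = w' ord0 s) -> H w = H w') ->
  #|[set w | H w]|
    = (#|F| ^ #|A| * #|[set w | H w && [forall s in A, w ord0 s == 0%R]]|)%N.
Proof.
move=> invH.
pose f w := [ffun s => if s \in A then w ord0 s else 0] : {ffun I -> F}.
pose D := pffun_on (0 : F) (mem A) predT.
rewrite (card_fibers f) -(card_pffun_on (0 : F) (mem A) predT) -/D -sum_nat_const.
rewrite [RHS]big_mkcond /=; apply: eq_bigr => j _.
have fD w : f w \in D.
  apply/pffun_onP; split=> //; apply/subsetP => s; rewrite inE ffunE.
  by case: ifP => //; rewrite eqxx.
case: ifPn => [/pffun_onP[jA _]|jD]; last first.
  apply: eq_card0 => w; rewrite inE; apply/negP => /andP[_ /eqP fw].
  by rewrite -fw fD in jD.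
pose e : seqs := [ffun i => if i == ord0 then j else 0].
rewrite -(@card_preimset _ (fun w => w + e)); last exact: addIr.
apply: eq_card => w; rewrite !inE; congr (_ && _).
  apply: invH => [i /negbTE i0|s sA]; rewrite !ffunE ?i0 ?eqxx ?addr0 //.
  have /eqP -> : j s == 0 by apply: contraR sA => /(subsetP jA).
  by rewrite addr0.
apply/eqP/forall_inP => [fE s sA|w0].
  have /ffunP/(_ s) := fE; rewrite !ffunE sA eqxx => /eqP.
  by rewrite -subr_eq0 addrK.
apply/ffunP => s; rewrite !ffunE eqxx.
case: ifPn => [/w0/eqP->|sA]; first by rewrite add0r.
by apply/esym/eqP; apply: contraR sA => /(subsetP jA).
Qed.

Definition active kap := [set s | (0 < kap s)%N].

Definition determined_by_tail L H := forall w w', w ord0 = w' ord0 ->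
  (forall i : 'I_N.+1, (L <= i)%N -> w i = w' i) -> H w = H w'.

(** The proportion of invertible matrices among the square matrices of size [a - 1] over [F]. *)
Definition full_rank_ratio (a : nat) : rat :=
  \prod_(1 <= i < a) (1 - 1 / #|F|%:R ^+ i).

(** Row [i] of [unshear] reads rows [i] and [i - 1], which costs one index. Row 0 wraps around to
    row [N], which lies in the tail as [L <= N]. *)
Lemma determined_by_tail_unshear L r (a : I -> F) H : (L <= N)%N ->
  determined_by_tail L.+1 H ->
  determined_by_tail L (fun w => H (unshear r a w)).
Proof.
move=> leLN detH w w' w0 wt; apply: detH => [|i ltLi]; apply/ffunP => s.
  by rewrite !ffunE w0 (wt (ord_pred ord0)) //= modn_small.
rewrite !ffunE (wt i) 1?ltnW // (wt (ord_pred i)) //=.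
case: i ltLi => -[//|i] lti /= ltLi.
by rewrite modnDr modn_small // ltnW.
Qed.

Lemma card_shear r (a : I -> F) H :
  #|[set w | H (unshear r a w)]| = #|[set w | H w]|.
Proof.
rewrite -(@card_preimset _ (shear r a)); last exact: can_inj (shearK r a).
by apply: eq_card => w; rewrite !inE shearK.
Qed.

(* [H] may constrain the constant terms, and the coefficients that do not enter
   the matrix: [shear] moves some coefficients there at each step, so this makes
   the statement amenable to induction. *)
Lemma card_nonsingular kap H : (\sum_s kap s <= N.+1)%N ->
  determined_by_tail (\sum_s kap s) H ->
  (forall w, H w -> exists2 s, (0 < kap s)%N & w ord0 s != 0) ->
  #|[set w | H w && nonsingular kap w]|%:R
    = full_rank_ratio #|active kap| * #|[set w | H w]|%:R :> rat.
Proof.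
move: {-1}(\sum_s kap s)%N (erefl (\sum_s kap s)%N) => L.
elim: L => [|L IHL] in kap H *.
  move=> sum0 _ _ H0.
  have HF w : ~~ H w.
    apply/negP => /H0[s]; move/eqP: sum0; rewrite sum_nat_eq0 => /forallP/(_ s).
    by move=> /eqP->.
  rewrite (card_set_pred0 HF) mulr0 card_set_pred0 // => w.
  by rewrite negb_and HF.
move=> sumE leLN.
(* Conditioning on the constant terms [v] gives all the systems counted the same pivot and the same
   multipliers [a]. *)
suff fixed v H1 : determined_by_tail L.+1 H1 -> (forall w, H1 w -> w ord0 = v) ->
    (exists2 s, (0 < kap s)%N & v s != 0) ->
    #|[set w | H1 w && nonsingular kap w]|%:R
      = full_rank_ratio #|active kap| * #|[set w | H1 w]|%:R :> rat.
  move=> detH H0; pose f w := w ord0.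
  rewrite (card_fibers f H) (card_fibers f) !natr_sum mulr_sumr.
  apply: eq_bigr => v _.
  have [/existsP[s /andP[ks vs]]|v0] := boolP [exists s, (0 < kap s)%N && (v s != 0)].
    rewrite -(fixed v); last by exists s.
    - by congr _%:R; apply: eq_card => w; rewrite !inE andbAC.
    - by move=> w w' w0 wt; rewrite /f w0 (detH w w').
    - by move=> w /andP[_ /eqP].
  have H1F w : ~~ (H w && (f w == v)).
    apply: contra v0 => /andP[/H0[s ks ws] /eqP <-].
    by apply/existsP; exists s; rewrite ks.
  rewrite (card_set_pred0 H1F) mulr0 card_set_pred0 // => w.
  by rewrite andbAC negb_and H1F.
move: H1 {H} => H detH Hv [s0 ks0 vs0].
case: (@arg_maxnP _ s0 (fun s => v s != 0) kap) => // r vr max_r.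
have kr : (0 < kap r)%N := leq_trans ks0 (max_r s0 vs0).
pose a s := v s / v r; pose H' w := H (unshear r a w).
have ar : a r = 1 by rewrite /a divff.
have H'r w : H' w -> w ord0 r != 0.
  by move=> /Hv /ffunP/(_ r); rewrite !ffunE eqxx => ->.
have detH' : determined_by_tail L H' by apply: determined_by_tail_unshear.
have sum' : \sum_s shrink kap r s = L.
  by apply: succn_inj; rewrite -sum_shrink.
rewrite -(card_shear r a H) -/H'.
rewrite -(card_shear r a (fun w => H w && nonsingular kap w)).
have -> : [set w | H' w && nonsingular kap (unshear r a w)]
        = [set w | H' w && nonsingular (shrink kap r) w].
  apply/setP => w; rewrite !inE; case: (boolP (H' w)) => //= /Hv w0.
  rewrite -{2}(unshearK r a w) nonsingular_shear ?w0 //.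
    by move=> s; rewrite /a divfK.
  by move=> s as0; apply: max_r; apply: contraNneq as0; rewrite /a => ->; rewrite mul0r.
(* If block [r] survives, the active blocks are unchanged and [t_r(0)] is still nonzero, so
   induction applies directly. *)
have [kr1|kr1] := ltnP 1 (kap r).
  have -> : active kap = active (shrink kap r).
    apply/setP => s; rewrite !inE /shrink subn_gt0.
    by case: eqP => //= ->; rewrite kr kr1.
  apply: IHL; rewrite ?sum' //; first exact: ltnW.
  by move=> w H'w; exists r; rewrite ?H'r // /shrink eqxx subn_gt0.
have {kr1}krE : kap r = 1%N by apply/eqP; rewrite eqn_leq kr1.
set A' := active (shrink kap r).
have A'E : A' = active kap :\ r.
  apply/setP => s; rewrite !inE /shrink subn_gt0.
  by case: eqP => //= ->; rewrite krE.
have cardA : #|active kap| = #|A'|.+1.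
  by rewrite A'E (cardsD1 r) inE kr.
rewrite cardA.
have [A'0|A'_gt0] := posnP #|A'|.
  rewrite A'0 /full_rank_ratio big_geq // mul1r; congr _%:R.
  apply: eq_card => w; rewrite !inE (_ : nonsingular _ _) ?andbT //.
  apply/nonsingularP => p szp _ s; apply/eqP; rewrite -size_poly_leq0.
  rewrite (leq_trans (szp s)) // leqNgt; apply/negP => ks.
  by have := card0_eq A'0 s; rewrite inE ks.
have L_gt0 : (0 < L)%N.
  have /card_gt0P[s] := A'_gt0; rewrite inE -sum' => ks.
  by rewrite (leq_trans ks) // (bigD1 s) //= leq_addr.
(* Systems whose remaining constant terms all vanish are singular; dropping them restores the
   hypothesis needed for induction. *)
pose H2 w := H' w && [exists s in A', w ord0 s != 0].
have -> : [set w | H' w && nonsingular (shrink kap r) w]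
        = [set w | H2 w && nonsingular (shrink kap r) w].
  apply/setP => w; rewrite !inE /H2; case: (H' w) => //=.
  case: exists_inP => //= w0; apply/negbTE.
  apply: zero_row_singular; first by rewrite sum'.
  by move=> s ks; apply/eqP; apply/negPn/negP => ws; case: w0; exists s; rewrite ?inE.
rewrite (IHL _ H2) ?sum' //; first last.
- by move=> w /andP[_ /exists_inP[s]]; rewrite inE => ks ws; exists s.
- by move=> w w' w0 wt; rewrite /H2 w0 (detH' w w').
- exact: ltnW.
rewrite /full_rank_ratio [in RHS]big_nat_recr //= -mulrA; congr (_ * _).
(* [unshear] moves the constant terms in [A'] to row 1, which [H] cannot see because [L > 0]. *)
have unifH : #|[set w | H' w]|
    = (#|F| ^ #|A'| * #|[set w | H' w && [forall s in A', w ord0 s == 0%R]]|)%N.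
  apply: card_uniform_row0 => w w' wt w0.
  apply: (@detH) => [|i ltLi]; apply/ffunP => s; rewrite !ffunE.
    rewrite (w0 r) ?A'E ?inE ?eqxx // (wt (ord_pred ord0)) //.
    by rewrite -val_eqE /= modn_small // -lt0n (leq_trans L_gt0).
  have i0 : i != ord0 by rewrite -val_eqE -lt0n (leq_trans _ ltLi).
  rewrite (wt i) // (wt (ord_pred i)) //.
  case: i {i0} ltLi => -[//|i] lti /= ltLi.
  by rewrite -val_eqE /= modnDr modn_small -?lt0n ?(leq_trans L_gt0) // ltnW.
have splitH : (#|[set w | H' w]| = #|[set w | H2 w]|
    + #|[set w | H' w && [forall s in A', w ord0 s == 0%R]]|)%N.
  rewrite -(cardsID [set w : seqs | [exists s in A', w ord0 s != 0]] [set w | H' w]).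
  congr (_ + _)%N; apply: eq_card => w; rewrite !inE // andbC negb_exists_in.
  by under eq_forallb_in do rewrite negbK.
have qE : (#|F|%:R ^+ #|A'| : rat) != 0.
  by rewrite expf_neq0 // pnatr_eq0 -lt0n ltnW // card_finNzRing_gt1.
apply: (mulfI qE); rewrite mulrA mulrBr mulr1 mul1r divff // mulrBl mul1r.
rewrite {2}unifH splitH natrM natrX natrD mulrDr.
by rewrite addrK.
Qed.

End Counting.

(** * Splitting indices by residue *)

(** The number of [j < k] congruent to [s] modulo [n + 1], as the ceiling of [(k - s) / (n + 1)]. *)
Definition residue_count n k (s : 'I_n.+1) : nat := ((k + n - s) %/ n.+1)%N.

Lemma ltn_residue_count n k (s : 'I_n.+1) c :
  (c < residue_count k s)%N = (s + n.+1 * c < k)%N.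
Proof.
rewrite /residue_count leq_divRL // mulSn mulnC.
have := ltn_ord s; move: (n.+1 * c)%N => m; lia.
Qed.

Lemma residue_countE n q r (s : 'I_n.+1) : (r <= n.+1)%N ->
  residue_count (q * n.+1 + r) s = (q + (s < r))%N.
Proof.
move=> ler; have lts := ltn_ord s.
rewrite /residue_count -addnA -addnBA; last by lia.
rewrite divnMDl //; congr (_ + _)%N; case: ltnP => sr.
  have -> : (r + n - s = 1 * n.+1 + (r - s.+1))%N by lia.
  by rewrite divnMDl // divn_small //; lia.
by rewrite divn_small //; lia.
Qed.

Lemma sum_residues (V : nmodType) n k (f : nat -> V) :
  \sum_(j < k) f j
    = \sum_(s < n.+1) \sum_(c < residue_count k s) f (s + n.+1 * c)%N.
Proof.
elim: k => [|k IHk].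
  rewrite big_ord0 big1 // => s _; rewrite (_ : residue_count 0 s = 0%N) ?big_ord0 //.
  by have := ltn_residue_count 0 s 0; rewrite ltn0 lt0n => /negbT; rewrite negbK => /eqP.
rewrite big_ord_recr IHk /=.
have rk : (k %% n.+1 < n.+1)%N by rewrite ltn_mod.
pose r := Ordinal rk.
rewrite (bigD1 r) //= [in RHS](bigD1 r) //= -!addrA [X in _ + X]addrC addrA.
have kE : k = (k %/ n.+1 * n.+1 + k %% n.+1)%N := divn_eq _ _.
have kS : k.+1 = (k %/ n.+1 * n.+1 + (k %% n.+1).+1)%N by rewrite addnS -kE.
have cS (s : 'I_n.+1) : residue_count k.+1 s = (k %/ n.+1 + (s <= k %% n.+1))%N.
  by rewrite [in LHS]kS residue_countE.
have c0 (s : 'I_n.+1) : residue_count k s = (k %/ n.+1 + (s < k %% n.+1))%N.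
  by rewrite [in LHS]kE residue_countE // ltnW.
congr (_ + _).
  rewrite cS c0 /= leqnn ltnn addn0 addn1 big_ord_recr /=.
  by rewrite mulnC [(_ + _ * _)%N]addnC -kE.
apply: eq_bigr => s neq_sr; rewrite cS c0.
have neq_s : (s == (k %% n.+1)%N :> nat) = false by apply: negbTE.
by rewrite [(s <= _)%N]leq_eqVlt neq_s.
Qed.

Lemma sum_residue_count n k : (\sum_(s < n.+1) residue_count k s)%N = k.
Proof.
have := @sum_residues nat n k (fun=> 1%N); rewrite sum1_card card_ord => {2}->.
by apply: eq_bigr => s _; rewrite sum1_card card_ord.
Qed.

(** * The Jacobi-Trudi matrix as a system of series *)

Lemma jt_coef_lt0 (R : nzRingType) (z : nat -> R) (m : int) :
  (m < 0)%R -> jt_coef z m = 0.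
Proof. by case: m. Qed.

(* Reading rows and columns of the Jacobi-Trudi matrix backwards, its entries
   become [z_(p + (n + 1) i - j)]; the indices congruent to [p - s] modulo
   [n + 1] form the [s]-th series. *)
Definition staircase_rows (F : finFieldType) p n N (z : nat -> F) :
  seqs F 'I_n.+1 N :=
  [ffun i : 'I_N.+1 => [ffun s : 'I_n.+1 =>
     jt_coef z (p%:Z - (s : nat)%:Z + (n.+1 * i)%N%:Z)]].

Lemma staircase_rowsE (F : finFieldType) p n N (z : nat -> F) i s :
  staircase_rows p n N z i s
    = jt_coef z (p%:Z - (s : nat)%:Z + (n.+1 * i)%N%:Z).
Proof. by rewrite !ffunE. Qed.

(** For [j = s + (n + 1) c], coefficient [c] of [b s] meets coefficient [i - c] of the [s]-th
    series, whose index [p - s + (n + 1) (i - c)] is [p + (n + 1) i - j]. *)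
Lemma coef_sum_staircase (F : finFieldType) p n N k (z : nat -> F)
    (b : 'I_n.+1 -> {poly F}) i :
  (p <= n)%N -> (k <= N.+1)%N -> (i < k)%N ->
  (forall s, (size (b s) <= residue_count k s)%N) ->
  (\sum_s b s * series (staircase_rows p n N z) s)`_i
    = \sum_(j < k) (b (inord (j %% n.+1)))`_(j %/ n.+1)
                    * jt_coef z (p%:Z + (n.+1 * i)%N%:Z - j%:Z).
Proof.
move=> lepn lekN ltik szb; rewrite coef_sum.
rewrite (@sum_residues _ n k (fun j => (b (inord (j %% n.+1)))`_(j %/ n.+1)
  * jt_coef z (p%:Z + (n.+1 * i)%N%:Z - j%:Z))).
apply: eq_bigr => s _.
have -> : b s = \sum_(c < residue_count k s) (b s)`_c *: 'X^c.
  rewrite -poly_def; apply/polyP => c; rewrite coef_poly.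
  by case: ltnP => // lec; rewrite nth_default // (leq_trans (szb s)).
rewrite mulr_suml coef_sum; apply: eq_bigr => c _.
rewrite -scalerAl coefZ coefXnM.
have [cs cd] : ((s + n.+1 * c) %% n.+1 = s /\ (s + n.+1 * c) %/ n.+1 = c)%N.
  by rewrite addnC mulnC modnMDl divnMDl // modn_small // divn_small // addn0.
rewrite cs cd inord_val; congr (_ * _).
(* For [i < c] nothing is left of the product, and the index on the right is negative because
   [p <= n]. *)
case: ltnP => [ltic|leci].
  rewrite jt_coef_lt0 //; have := ltn_ord s; nia.
have ltiN : (i - c < N.+1)%N by lia.
rewrite (coef_series _ s (Ordinal ltiN)) !ffunE /=; congr jt_coef.
have := leq_mul (leqnn n.+1) leci; rewrite mulnBr.
move: (n.+1 * c)%N (n.+1 * i)%N => x y lexy; lia.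
Qed.

Lemma jacobi_trudi_rev (F : finFieldType) p n k (z : nat -> F) (i j : 'I_k) :
  jacobi_trudi (@stair p n k) z (rev_ord i) (rev_ord j)
    = jt_coef z (p%:Z + (n.+1 * i)%N%:Z - (j : nat)%:Z).
Proof.
rewrite mxE /stair /=; congr jt_coef.
have := ltn_ord i; have := ltn_ord j; nia.
Qed.

(** [det0P] speaks of left kernels, hence the transpose. Read backwards, entry [j] of a kernel
    vector is coefficient [j %/ n.+1] of the polynomial numbered [j %% n.+1]. *)
Lemma det_jacobi_trudi_eq0 (F : finFieldType) p n k N (z : nat -> F) :
  (p <= n)%N -> (k <= N.+1)%N ->
  (\det (jacobi_trudi (@stair p n k) z) == 0)
    = ~~ nonsingular (@residue_count n k) (staircase_rows p n N z).
Proof.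
move=> lepn lekN; rewrite -det_tr; set J := jacobi_trudi _ z.
have mulJ (v : 'rV_k) (i : 'I_k) : (v *m J^T) 0 (rev_ord i)
    = \sum_(j < k) v 0 (rev_ord j) * jt_coef z (p%:Z + (n.+1 * i)%N%:Z - (j : nat)%:Z).
  rewrite mxE (reindex_inj rev_ord_inj) /=; apply: eq_bigr => j _.
  by rewrite mxE jacobi_trudi_rev.
apply/det0P/idP => [[v v0 vJ]|].
  apply: contra v0 => /nonsingularP ns.
  pose u j := if (insub j : option 'I_k) is Some j' then v 0 (rev_ord j') else 0.
  pose b (s : 'I_n.+1) := \poly_(c < residue_count k s) u (s + n.+1 * c)%N.
  have bE (j : 'I_k) : (b (inord (j %% n.+1)))`_(j %/ n.+1) = v 0 (rev_ord j).
    have jE : (j %% n.+1 + n.+1 * (j %/ n.+1) = j)%N by rewrite addnC mulnC -divn_eq.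
    rewrite coef_poly ltn_residue_count inordK ?ltn_mod // jE ltn_ord.
    by rewrite /u valK.
  have b0 : forall s, b s = 0.
    apply: ns => [s|i]; first exact: size_poly.
    rewrite sum_residue_count => ltik.
    rewrite (coef_sum_staircase z lepn lekN ltik) => [|s]; last exact: size_poly.
    have := mulJ v (Ordinal ltik); rewrite vJ mxE => E; rewrite [RHS]E.
    by apply: eq_bigr => j _; rewrite bE.
  apply/eqP/rowP => j; rewrite mxE -(rev_ordK j) -bE b0.
  exact: coef0.
move=> ns; apply/det0P; apply: contraNT ns => /det0P det_neq0.
apply/nonsingularP => b szb bt s.
pose v : 'rV[F]_k :=
  \row_j (b (inord (rev_ord j %% n.+1)))`_(rev_ord j %/ n.+1).
have vJ : v *m J^T = 0.
  apply/rowP => i; rewrite -(rev_ordK i) mulJ mxE.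
  have := bt (rev_ord i); rewrite sum_residue_count ltn_ord => /(_ isT).
  rewrite (coef_sum_staircase z lepn lekN (ltn_ord _)) // => E; rewrite -[RHS]E.
  by apply: eq_bigr => j _; rewrite mxE rev_ordK.
have v0 : v = 0.
  apply/eqP; apply: contraTT isT => v0; case: det_neq0.
  by exists v.
apply/polyP => c; rewrite coef0.
have [ltc|lec] := ltnP c (residue_count k s); last first.
  by rewrite nth_default // (leq_trans (szb s)).
rewrite ltn_residue_count in ltc.
have /rowP/(_ (rev_ord (Ordinal ltc))) := v0; rewrite !mxE rev_ordK /=.
by rewrite addnC mulnC modnMDl divnMDl // modn_small // divn_small // addn0 inord_val.
Qed.

(** * From tuples to systems, and the probability *)

(* With [N + n] for the last row, every variable occurs in some row. *)
Lemma staircase_rows_inj (F : finFieldType) p n N : (p <= n)%N ->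
  injective (fun t : N.-tuple F => staircase_rows p n (N + n) (seq_of_tuple t)).
Proof.
move=> lepn t u eq_tu; apply: eq_from_tnth => m.
(* The variable [z_(m+1)] sits in row [i], column [s] when [m + 1 + n - p = (n + 1) i + (n - s)],
   where [n - s] is a genuine remainder. *)
pose x := (m.+1 + n - p)%N.
have xE : x = (x %/ n.+1 * n.+1 + x %% n.+1)%N := divn_eq _ _.
have xr : (x %% n.+1 < n.+1)%N by rewrite ltn_mod.
have xq : (x %/ n.+1 < (N + n).+1)%N.
  by rewrite ltnS (leq_trans (leq_div _ _)) // /x; have := ltn_ord m; lia.
have := congr1 (fun w : seqs F 'I_n.+1 (N + n) =>
  w (Ordinal xq) (rev_ord (Ordinal xr))) eq_tu.
rewrite !ffunE /= (_ : _ + _ = m.+1%:Z); first by rewrite /seq_of_tuple /= -!tnth_nth.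
by rewrite /x in xE xr *; lia.
Qed.

(** Rows [0 < i < k] hold distinct variables of index at most [N], so they are free. Values fixed by
    convention occur only in row 0 or, for indices above [N], from row [k] on. *)
Lemma staircase_rows_tail (F : finFieldType) p n N k :
  (p <= n)%N -> (n < k)%N -> (p + (k - 1) * n - 1 + k <= N)%N ->
  determined_by_tail k (fun w : seqs F 'I_n.+1 (N + n) =>
    [exists t : N.-tuple F, w == staircase_rows p n (N + n) (seq_of_tuple t)]).
Proof.
move=> lepn ltnk hN.
suff tail (w w' : seqs F 'I_n.+1 (N + n)) : w ord0 = w' ord0 ->
    (forall i : 'I_(N + n).+1, (k <= i)%N -> w i = w' i) ->
    [exists t : N.-tuple F, w == staircase_rows p n (N + n) (seq_of_tuple t)] ->
    [exists t : N.-tuple F, w' == staircase_rows p n (N + n) (seq_of_tuple t)].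
  by move=> w w' w0 wt; apply/idP/idP; apply: tail => // i lei; rewrite wt.
move=> w0 wt /existsP[t /eqP wE]; apply/existsP.
pose val m := let x := (m + n - p)%N in
  w' (inord (x %/ n.+1)) (rev_ord (inord (x %% n.+1))).
pose u := [tuple val m.+1 | m < N].
have uE (m : 'I_N) : u`_m = val m.+1 by rewrite nth_mktuple.
exists u; apply/eqP/ffunP => i; apply/ffunP => s.
rewrite staircase_rowsE.
have lts := ltn_ord s.
case E: (p%:Z - (s : nat)%:Z + (n.+1 * i)%N%:Z) => [[|m]|m] /=.
- have i0 : i = ord0 by apply: val_inj => /=; nia.
  by move: E; rewrite i0 -w0 wE staircase_rowsE => ->.
- have xE : (m.+1 + n - p = i * n.+1 + (n - s))%N by nia.
  have valE : val m.+1 = w' i s.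
    rewrite /val xE divnMDl // modnMDl divn_small; last by lia.
    rewrite modn_small; last by lia.
    rewrite addn0 inord_val; congr (w' _ _).
    by apply: val_inj; rewrite /= inordK; lia.
  rewrite /seq_of_tuple /=; have [ltmN|leNm] := ltnP m N.
    by rewrite (uE (Ordinal ltmN)) valE.
  (* An index above [N] cannot occur in the first [k] rows, by [hN]; so [w] and [w'] agree here and
     both hold the junk value 0. *)
  have leki : (k <= i)%N.
    rewrite leqNgt; apply/negP => ltik.
    have leik : (i <= k - 1)%N by lia.
    have := leq_mul (leqnn n.+1) leik; rewrite [leqRHS]mulSn.
    move: E hN leNm; move: (n.+1 * i)%N => x; rewrite [(_ * n)%N]mulnC.
    by move: (n * (k - 1))%N => y; lia.
  rewrite nth_default ?size_tuple ?card_ord // -wt //.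
  by rewrite wE staircase_rowsE E /= /seq_of_tuple nth_default ?size_tuple.
- have i0 : i = ord0 by apply: val_inj => /=; nia.
  by move: E; rewrite i0 -w0 wE staircase_rowsE => ->.
Qed.

(* The largest index of a variable in the matrix is lambda_1 - 1 + k, so N is
   large enough as soon as it is at least this. *)
Theorem theorem1p1 (F : finFieldType) (q : nat) (hq : #|F| = q)
    (p n k : nat) (hp : (0 < p)%N) (hpn : (p <= n)%N) (hnk : (n <= k - 1)%N)
    (N : nat) (hN : (p + (k - 1) * n - 1 + k <= N)%N) :
  proportion [set t : N.-tuple F |
      \det (jacobi_trudi (@stair p n k) (seq_of_tuple t)) == 0]
  = 1 - \prod_(1 <= i < n.+1) (1 - 1 / q%:R ^+ i).
Proof.
have ltnk : (n < k)%N by lia.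
have lekN : (k <= (N + n).+1)%N by nia.
pose W (t : N.-tuple F) := staircase_rows p n (N + n) (seq_of_tuple t).
have W_inj : injective W by exact: staircase_rows_inj.
pose kap := @residue_count n k.
pose H w := [exists t, w == W t].
have cardH (P : pred (seqs F 'I_n.+1 (N + n))) :
    #|[set w | H w && P w]| = #|[set t | P (W t)]|.
  rewrite -(card_imset _ W_inj); apply: eq_card => w; rewrite inE.
  apply/andP/imsetP => [[/existsP[t /eqP ->] Pt]|[t + ->]].
    by exists t; rewrite ?inE.
  by rewrite inE => Pt; split=> //; apply/existsP; exists t.
have ratio : #|[set t | nonsingular kap (W t)]|%:R
    = \prod_(1 <= i < n.+1) (1 - 1 / q%:R ^+ i) * #|{: N.-tuple F}|%:R :> rat.
  rewrite -cardH card_nonsingular ?sum_residue_count //; first last.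
  (* Block [p] has constant term [z_0 = 1], and it is active since [p <= n < k]. *)
  - move=> w /existsP[t /eqP ->]; exists (inord p).
      by rewrite ltn_residue_count muln0 addn0 inordK ?ltnS // (leq_ltn_trans hpn).
    by rewrite !ffunE inordK ?ltnS // muln0 addr0 subrr oner_eq0.
  - exact: staircase_rows_tail.
  congr (_ * _%:R); last first.
    rewrite -cardsT -(card_imset _ W_inj); apply: eq_card => w; rewrite inE.
    apply/existsP/imsetP => [[t /eqP ->]|[t _ ->]]; first by exists t.
    by exists t.
  rewrite /full_rank_ratio hq (_ : active _ = setT) ?cardsT ?card_ord //.
  apply/setP => s; rewrite !inE ltn_residue_count muln0 addn0.
  exact: leq_trans (ltn_ord s) ltnk.
have compl : (#|{: N.-tuple F}| = #|[set t | nonsingular kap (W t)]|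
    + #|[set t : N.-tuple F |
          \det (jacobi_trudi (@stair p n k) (seq_of_tuple t)) == 0%R]|)%N.
  rewrite -cardsT -(cardsID [set t | nonsingular kap (W t)] setT) setTI setTD.
  congr (_ + _)%N; apply: eq_card => t.
  by rewrite !inE (@det_jacobi_trudi_eq0 _ _ _ _ (N + n)).
have T_neq0 : #|{: N.-tuple F}|%:R != 0 :> rat.
  rewrite pnatr_eq0 card_tuple expn_eq0 negb_and -lt0n ltnW //.
  exact: card_finNzRing_gt1.
rewrite /proportion; apply: (mulIf T_neq0); rewrite divfK // mulrBl mul1r -ratio.
by rewrite compl natrD addrC addKr.
Qed.
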